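(* Let $0\leq \alpha<1$ and $\beta>1$. If a function $f$ belongs to the class $\mathcal{V}(\alpha,\beta)$, then $\|f\|<\infty$.
   Context: $\Delta=\{z\in\mathbb{C}:|z|<1\}$ is the open unit disc. $\mathcal{A}$ is the family of analytic functions $f$ on $\Delta$ normalized by $f(0)=0$, $f'(0)=1$. For $0\leq\alpha<1$ and $\beta>1$, the class $\mathcal{V}(\alpha,\beta)$ consists of all $f\in\mathcal{A}$ satisfying $$\alpha<\mathrm{Re}\left\{\left(\frac{z}{f(z)}\right)^2f'(z)\right\}<\beta\quad(z\in\Delta),$$ where $z/f(z)$ is given its limit value $1$ at $z=0$. For a locally univalent analytic function $f$ on $\Delta$, the norm of the pre-Schwarzian derivative is $$\|f\|=\sup_{z\in\Delta}(1-|z|^2)\left|\frac{f''(z)}{f'(z)}\right|.$$ *)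

(* Defs.v *)
From Stdlib Require Import Reals.
From Coquelicot Require Import Coquelicot.
Open Scope R_scope.

Definition in_disc (z : C) : Prop := Cmod z < 1.

Definition analytic_at (f : C -> C) (z0 : C) : Prop :=
  exists (a : nat -> C) (r : R), 0 < r /\
    forall z : C, Cmod (z - z0) < r ->
      is_pseries a (z - z0)%C (f z).

Definition analytic_on_disc (f : C -> C) : Prop :=
  forall z : C, in_disc z -> analytic_at f z.

Definition class_A (f : C -> C) : Prop :=
  analytic_on_disc f /\ f 0 = 0%C /\ C_derive f 0 = 1%C.

Definition id_over (f : C -> C) (z : C) : C :=
  if Ceq_dec z 0 then 1%C else (z / f z)%C.

(* [f z <> 0] says that the quotient z / f z is a genuine one; division by
   zero is a total operation here. *)
Definition class_V (alpha beta : R) (f : C -> C) : Prop :=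
  class_A f /\
  (forall z : C, in_disc z -> z <> 0%C -> f z <> 0%C) /\
  (forall z : C, in_disc z ->
     alpha < Re (id_over f z ^ 2 * C_derive f z)%C < beta).

Definition pre_schwarzian (f : C -> C) (z : C) : C :=
  (C_derive (C_derive f) z / C_derive f z)%C.

Definition pre_schwarzian_norm (f : C -> C) : Rbar :=
  Lub_Rbar (fun x : R => exists z : C, in_disc z /\
    x = (1 - Cmod z ^ 2) * Cmod (pre_schwarzian f z)).

(* Main.v *)
Require Import Defs.
From Stdlib Require Import Reals Lra Lia.
From Coquelicot Require Import Coquelicot.

(** Put [W(zeta) = 1 / f(1 / zeta)] for [|zeta| > 1].  With [z = 1 / zeta] its derivative is
    [Q(zeta) = (z / f(z))^2 f'(z)], which has positive real part, and [W] has no zero.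
    Logarithmic differentiation of [Q] gives
    [f''(z) / f'(z) = - zeta^2 Q'/Q - 2 zeta + 2 zeta^2 Q/W],
    so away from [z = 0] it suffices to bound [Q'/Q] and [Q/W] by a constant over
    [|zeta| - 1]; near [z = 0] the quotient [f''/f'] is continuous, as [f'(0) = 1].

    Both bounds are local, on the disc of radius [r = |zeta| - 1] about [zeta].

    - [Re_pos_deriv_bound]: a function [q] with [Re q >= 0] on a disc of radius [r] about
      [c] satisfies [|q'(c)| r <= 4 Re q(c)].  It follows from the mean value property
      on circles, proved by differentiating the circular mean in the radius.

    - [nonvanishing_lower_bound]: a zero-free [W] with [Re W' >= 0] on that disc satisfies
      [|W'(c)| r <= 128 |W(c)|].  Indeed the first bound forces [W'] to be nearly constant
      on a disc of radius [r / 64] ([Re_pos_oscillation]); were [W(c)] too small, Newton's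
      iteration would converge to a zero of [W] ([newton_zero]).

    The complex analysis used is elementary: functions with a continuous complex derivative, and
    the fact that a sum of a power series is such a function, together with its
    derivatives ([analytic_at_C_derive]). *)

(** * Continuity of complex-valued functions *)

(** Coquelicot's carriers are convertible to [C] but hide it from [ring];
    [C_eq] restores the type of an equation. *)
Ltac C_eq := match goal with |- @eq _ ?a ?b => change (@eq C a b) end.

Lemma Cmod_diag (z : C) : Cmod (z - z) = 0.
Proof. replace (z - z)%C with (RtoC 0) by ring. apply Cmod_0. Qed.

Section ComplexContinuity.
Context {U : UniformSpace}.
Implicit Types (F G : U -> C) (x : U).

Lemma continuous_C_split F x :
  continuous (fun y => Re (F y)) x -> continuous (fun y => Im (F y)) x ->
  continuous F x.
Proof.
  intros H1 H2.
  apply continuous_ext with (f := fun y => (Re (F y), Im (F y))).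
  - intros y; now rewrite (surjective_pairing (F y)).
  - apply (continuous_comp_2 (fun y => Re (F y)) (fun y => Im (F y)) (fun a b => (a, b) : C) x H1 H2).
    apply continuous_ext with (f := fun z : R * R => z).
    + intros [a b]; reflexivity.
    + apply continuous_id.
Qed.

Lemma continuous_Re F x : continuous F x -> continuous (fun y => Re (F y)) x.
Proof.
  intros H; apply (continuous_comp F (fun z : C => fst z) x H), continuous_fst.
Qed.

Lemma continuous_Im F x : continuous F x -> continuous (fun y => Im (F y)) x.
Proof.
  intros H; apply (continuous_comp F (fun z : C => snd z) x H), continuous_snd.
Qed.

Lemma continuous_Cplus F G x :
  continuous F x -> continuous G x -> continuous (fun y => F y + G y)%C x.
Proof.
  intros HF HG; apply continuous_C_split; simpl.
  - apply (continuous_plus (fun y => Re (F y)) (fun y => Re (G y)));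
      now apply continuous_Re.
  - apply (continuous_plus (fun y => Im (F y)) (fun y => Im (G y)));
      now apply continuous_Im.
Qed.

Lemma continuous_Copp F x :
  continuous F x -> continuous (fun y => - F y)%C x.
Proof.
  intros HF; apply continuous_C_split; simpl.
  - apply (continuous_opp (fun y => Re (F y))); now apply continuous_Re.
  - apply (continuous_opp (fun y => Im (F y))); now apply continuous_Im.
Qed.

Lemma continuous_Cmult F G x :
  continuous F x -> continuous G x -> continuous (fun y => F y * G y)%C x.
Proof.
  intros HF HG; apply continuous_C_split; simpl.
  - apply (continuous_minus (fun y => Re (F y) * Re (G y))%R (fun y => Im (F y) * Im (G y))%R);
    apply (continuous_mult (K := R_AbsRing));
      auto using continuous_Re, continuous_Im.
  - apply (continuous_plus (fun y => Re (F y) * Im (G y))%R (fun y => Im (F y) * Re (G y))%R);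
    apply (continuous_mult (K := R_AbsRing));
      auto using continuous_Re, continuous_Im.
Qed.

Lemma continuous_Cinv F x :
  continuous F x -> F x <> 0%C -> continuous (fun y => / F y)%C x.
Proof.
  intros HF Hx.
  assert (HN : continuous (fun y => / (Re (F y) ^ 2 + Im (F y) ^ 2))%R x).
  { apply (continuous_comp (fun y => Re (F y) ^ 2 + Im (F y) ^ 2)%R Rinv).
    - apply (continuous_plus (fun y => Re (F y) ^ 2)%R (fun y => Im (F y) ^ 2)%R).
      + apply (continuous_comp (fun y => Re (F y)) (fun t => t ^ 2)%R);
          [now apply continuous_Re|].
        apply continuity_pt_filterlim, derivable_continuous_pt, derivable_pt_pow.
      + apply (continuous_comp (fun y => Im (F y)) (fun t => t ^ 2)%R);
          [now apply continuous_Im|].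
        apply continuity_pt_filterlim, derivable_continuous_pt, derivable_pt_pow.
    - apply continuous_Rinv. intros H0. apply Hx.
      apply Cmod_eq_0. unfold Cmod.
      change (fst (F x)) with (Re (F x)); change (snd (F x)) with (Im (F x)).
      rewrite H0; apply sqrt_0. }
  apply continuous_C_split; simpl.
  - apply (continuous_mult (K := R_AbsRing) (fun y => Re (F y))); auto using continuous_Re.
  - apply (continuous_mult (K := R_AbsRing) (fun y => - Im (F y))%R); auto.
    apply (continuous_opp (fun y => Im (F y))); now apply continuous_Im.
Qed.
End ComplexContinuity.

(** The product neighbourhoods of a point of [C] are the Euclidean ones. *)
Lemma locally_Cmod (z : C) (P : C -> Prop) :
  locally z P <-> exists d, 0 < d /\ forall y, Cmod (y - z) < d -> P y.
Proof.
  split.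
  - intros [d Hd]. exists d; split; [apply cond_pos|].
    intros y Hy. apply Hd. now apply C_NormedModule_mixin_compat1.
  - intros (d & Hd & H).
    assert (H2 : 0 < sqrt 2) by (apply sqrt_lt_R0; lra).
    assert (Hp : 0 < d / sqrt 2) by (now apply Rdiv_lt_0_compat).
    exists (mkposreal _ Hp). intros y Hy. apply H.
    apply C_NormedModule_mixin_compat2 in Hy. simpl in Hy.
    replace (sqrt 2 * (d / sqrt 2)) with d in Hy by (field; lra).
    exact Hy.
Qed.

(** Continuity into [C], whose canonical uniform structure is that of [R * R],
    expressed with the modulus. *)
Lemma continuous_Cmod_lt {U : UniformSpace} (F : U -> C) x :
  continuous F x <-> forall eps, 0 < eps -> locally x (fun y => Cmod (F y - F x) < eps).
Proof.
  split.
  - intros H eps He. apply (H (fun w => Cmod (w - F x) < eps)).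
    apply locally_Cmod. exists eps; auto.
  - intros H P HP. apply locally_Cmod in HP as (d & Hd & HP).
    unfold filtermap; generalize (H d Hd). apply filter_imp; auto.
Qed.

(** * Complex derivatives *)

(** Complex differentiability in Caratheodory's form: near [z] the increment of [F]
    is [phi y * (y - z)] with [phi] continuous at [z] and [phi z = d].  In this form
    the rules of differentiation reduce to continuity of sums, products and
    quotients. *)
Definition Cderiv (F : C -> C) (z d : C) : Prop :=
  exists phi : C -> C, continuous phi z /\ phi z = d /\
    locally z (fun y => F y - F z = phi y * (y - z))%C.

Lemma Cderiv_continuous F z d : Cderiv F z d -> continuous F z.
Proof.
  intros (phi & Hc & _ & H).
  apply continuous_ext_loc with (g := fun y => (F z + phi y * (y + - z))%C).
  - revert H; apply filter_imp; intros y Hy.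
    C_eq. change (y + - z)%C with (y - z)%C. rewrite <- Hy. ring.
  - apply continuous_Cplus; [apply continuous_const|].
    apply continuous_Cmult; auto.
    apply continuous_Cplus; [apply continuous_id|apply continuous_const].
Qed.

(** [C_derive] is a total operator; on differentiable functions it is the derivative. *)
Lemma Cderiv_C_derive F z d : Cderiv F z d -> C_derive F z = d.
Proof.
  intros (phi & Hc & <- & H). apply is_C_lim_unique.
  apply filterlim_ext_loc with (f := phi).
  - unfold locally', within. revert H; apply filter_imp; intros y Hy Hyz.
    rewrite Hy. field. intros H0. apply Hyz.
    replace y with ((y - z) + z)%C by (C_eq; ring). rewrite H0; C_eq; ring.
  - intros P HP. unfold filtermap, locally', within.
    generalize (Hc P HP); unfold filtermap. apply filter_imp; auto.
Qed.

Lemma Cderiv_const c z : Cderiv (fun _ => c) z 0.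
Proof.
  exists (fun _ => 0%C); repeat split; [apply continuous_const|].
  apply filter_forall; intros y; C_eq; ring.
Qed.

Lemma Cderiv_id z : Cderiv (fun y => y) z 1.
Proof.
  exists (fun _ => 1%C); repeat split; [apply continuous_const|].
  apply filter_forall; intros y; C_eq; ring.
Qed.

Lemma Cderiv_plus F G z a b :
  Cderiv F z a -> Cderiv G z b -> Cderiv (fun y => F y + G y)%C z (a + b).
Proof.
  intros (p & Hp & <- & Ep) (q & Hq & <- & Eq).
  exists (fun y => p y + q y)%C; repeat split; [now apply continuous_Cplus|].
  generalize (filter_and _ _ Ep Eq). apply filter_imp; intros y [E1 E2].
  replace (F y + G y - (F z + G z))%C with ((F y - F z) + (G y - G z))%C by ring.
  rewrite E1, E2; C_eq; ring.
Qed.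

Lemma Cderiv_opp F z a : Cderiv F z a -> Cderiv (fun y => - F y)%C z (- a).
Proof.
  intros (p & Hp & <- & Ep).
  exists (fun y => - p y)%C; repeat split; [now apply continuous_Copp|].
  revert Ep. apply filter_imp; intros y E1.
  replace (- F y - - F z)%C with (- (F y - F z))%C by ring.
  rewrite E1; C_eq; ring.
Qed.

Lemma Cderiv_mult F G z a b :
  Cderiv F z a -> Cderiv G z b ->
  Cderiv (fun y => F y * G y)%C z (a * G z + F z * b).
Proof.
  intros HF HG. assert (HGc := Cderiv_continuous _ _ _ HG).
  destruct HF as (p & Hp & <- & Ep), HG as (q & Hq & <- & Eq).
  exists (fun y => p y * G y + F z * q y)%C; repeat split.
  - apply continuous_Cplus; apply continuous_Cmult; auto using continuous_const.
  - generalize (filter_and _ _ Ep Eq). apply filter_imp; intros y [E1 E2].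
    replace (F y * G y - F z * G z)%C with ((F y - F z) * G y + F z * (G y - G z))%C by ring.
    rewrite E1, E2; C_eq; ring.
Qed.

Lemma continuous_neq0 {U : UniformSpace} (F : U -> C) x :
  continuous F x -> F x <> 0%C -> locally x (fun y => F y <> 0%C).
Proof.
  intros H Hx. apply Cmod_gt_0 in Hx.
  generalize (proj1 (continuous_Cmod_lt F x) H _ Hx).
  apply filter_imp; intros y Hy E. rewrite E in Hy.
  replace (0 - F x)%C with (- F x)%C in Hy by ring.
  rewrite Cmod_opp in Hy; lra.
Qed.

Lemma Cderiv_inv F z a :
  Cderiv F z a -> F z <> 0%C -> Cderiv (fun y => / F y)%C z (- a / (F z * F z)).
Proof.
  intros HF Hz. assert (HFc := Cderiv_continuous _ _ _ HF).
  destruct HF as (p & Hp & <- & Ep).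
  exists (fun y => - p y * / (F y * F z))%C; repeat split.
  - apply continuous_Cmult; [now apply continuous_Copp|].
    apply continuous_Cinv; [|now apply Cmult_neq_0].
    apply continuous_Cmult; auto using continuous_const.
  - generalize (filter_and _ _ Ep (continuous_neq0 F z HFc Hz)).
    apply filter_imp; intros y [E1 E2].
    replace (/ F y - / F z)%C with (- (F y - F z) / (F y * F z))%C by (field; auto).
    rewrite E1; C_eq; field; auto.
Qed.

Lemma Cderiv_comp F G z a b :
  Cderiv F (G z) a -> Cderiv G z b -> Cderiv (fun y => F (G y)) z (a * b).
Proof.
  intros HF HG. assert (HGc := Cderiv_continuous _ _ _ HG).
  destruct HF as (p & Hp & <- & Ep), HG as (q & Hq & <- & Eq).
  exists (fun y => p (G y) * q y)%C; repeat split.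
  - apply continuous_Cmult; auto. now apply continuous_comp.
  - assert (Ep' : locally z (fun y => F (G y) - F (G z) = p (G y) * (G y - G z))%C)
      by exact (HGc _ Ep).
    generalize (filter_and _ _ Ep' Eq). apply filter_imp; intros y [E1 E2].
    rewrite E1, E2; C_eq; ring.
Qed.

(** [holo D F]: at every point of [D] the function [F] has a complex derivative,
    and this derivative is continuous there.  The set [D] is not assumed open; it is
    open in all the uses below. *)
Definition holo (D : C -> Prop) (F : C -> C) : Prop :=
  exists F' : C -> C, forall z, D z -> Cderiv F z (F' z) /\ continuous F' z.

Section Holo.
Variable D : C -> Prop.

Lemma holo_sub (E : C -> Prop) F : (forall z, E z -> D z) -> holo D F -> holo E F.
Proof. intros H [F' HF]; exists F'; auto. Qed.

Lemma holo_continuous F z : holo D F -> D z -> continuous F z.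
Proof. intros [F' H] Hz. eapply Cderiv_continuous, H, Hz. Qed.

Lemma holo_const c : holo D (fun _ => c).
Proof.
  exists (fun _ => 0%C); split; [apply Cderiv_const|apply continuous_const].
Qed.

Lemma holo_id : holo D (fun z => z).
Proof.
  exists (fun _ => 1%C); split; [apply Cderiv_id|apply continuous_const].
Qed.

Lemma holo_plus F G : holo D F -> holo D G -> holo D (fun z => F z + G z)%C.
Proof.
  intros [F' HF] [G' HG]; exists (fun z => F' z + G' z)%C; intros z Hz.
  destruct (HF z Hz), (HG z Hz); split.
  - now apply Cderiv_plus.
  - now apply continuous_Cplus.
Qed.

Lemma holo_opp F : holo D F -> holo D (fun z => - F z)%C.
Proof.
  intros [F' HF]; exists (fun z => - F' z)%C; intros z Hz.
  destruct (HF z Hz); split.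
  - now apply Cderiv_opp.
  - now apply continuous_Copp.
Qed.

Lemma holo_mult F G : holo D F -> holo D G -> holo D (fun z => F z * G z)%C.
Proof.
  intros HF0 HG0.
  assert (CF := holo_continuous F); assert (CG := holo_continuous G).
  destruct (HF0) as [F' HF], (HG0) as [G' HG];
  exists (fun z => F' z * G z + F z * G' z)%C; intros z Hz.
  destruct (HF z Hz), (HG z Hz); split.
  - now apply Cderiv_mult.
  - apply continuous_Cplus; apply continuous_Cmult; auto.
Qed.

Lemma holo_inv F : holo D F -> (forall z, D z -> F z <> 0%C) -> holo D (fun z => / F z)%C.
Proof.
  intros HF0 H0. assert (CF := holo_continuous F).
  destruct (HF0) as [F' HF].
  exists (fun z => - F' z / (F z * F z))%C; intros z Hz.
  destruct (HF z Hz); split.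
  - now apply Cderiv_inv; auto.
  - apply continuous_Cmult; [now apply continuous_Copp|].
    apply continuous_Cinv; [apply continuous_Cmult; auto|].
    apply Cmult_neq_0; auto.
Qed.

Lemma holo_comp (E : C -> Prop) F G :
  holo E F -> holo D G -> (forall z, D z -> E (G z)) -> holo D (fun z => F (G z)).
Proof.
  intros [F' HF] HG0 HDE. assert (CG := holo_continuous G).
  destruct (HG0) as [G' HG].
  exists (fun z => F' (G z) * G' z)%C; intros z Hz.
  destruct (HG z Hz), (HF (G z) (HDE z Hz)); split.
  - now apply Cderiv_comp.
  - apply continuous_Cmult; auto. apply continuous_comp; auto.
Qed.
End Holo.

(** [C_cont] and [C_holo] reduce continuity and differentiability of a polynomial
    expression to those of its constituents. *)
Ltac C_cont := repeat match goal with
  | |- continuous (fun _ => ?c) _ => apply continuous_const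
  | |- continuous (fun y => Cplus (@?F y) (@?G y)) _ => apply (continuous_Cplus F G)
  | |- continuous (fun y => Cminus (@?F y) (@?G y)) _ =>
      apply (continuous_Cplus F (fun y => - G y)%C)
  | |- continuous (fun y => Cmult (@?F y) (@?G y)) _ => apply (continuous_Cmult F G)
  | |- continuous (fun y => Copp (@?F y)) _ => apply (continuous_Copp F)
  end.

Ltac C_holo := repeat match goal with
  | |- holo _ (fun _ => ?c) => apply holo_const
  | |- holo _ (fun y => Cplus (@?F y) (@?G y)) => apply (holo_plus _ F G)
  | |- holo _ (fun y => Cminus (@?F y) (@?G y)) =>
      apply (holo_plus _ F (fun y => - G y)%C)
  | |- holo _ (fun y => Cmult (@?F y) (@?G y)) => apply (holo_mult _ F G)
  | |- holo _ (fun y => Copp (@?F y)) => apply (holo_opp _ F)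
  end.

(** * Derivatives along real curves *)

(** The next two lemmas identify Coquelicot's real derivative with a continuous slope,
    so that real curves can be composed with [Cderiv]. *)
Lemma is_derive_slope (g psi : R -> R) (t : R) :
  continuous psi t -> locally t (fun s => g s - g t = psi s * (s - t))%R ->
  is_derive g t (psi t).
Proof.
  intros Hc H. split; [apply is_linear_scal_l|].
  intros x Hx. 
  apply (is_filter_lim_locally_unique (V := AbsRing_NormedModule R_AbsRing)) in Hx. subst x.
  intros eps.
  assert (He : locally t (fun s => Rabs (psi s - psi t) < eps)).
  { apply (Hc (fun w => Rabs (w - psi t) < eps)). now exists eps. }
  generalize (filter_and _ _ H He). apply filter_imp. intros s [E1 E2].
  change (Rabs ((g s - g t) - (s - t) * psi t) <= eps * Rabs (s - t))%R.
  rewrite E1. replace (psi s * (s - t) - (s - t) * psi t)%R with ((psi s - psi t) * (s - t))%R by ring.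
  rewrite Rabs_mult. apply Rmult_le_compat_r; [apply Rabs_pos|lra].
Qed.

Lemma slope_of_is_derive (g : R -> R) (t l : R) :
  is_derive g t l ->
  exists psi : R -> R, continuous psi t /\ psi t = l /\
    forall s, (g s - g t = psi s * (s - t))%R.
Proof.
  intros [_ H].
  exists (fun s => if Req_EM_T s t then l else (g s - g t) / (s - t))%R.
  repeat split.
  - intros P [eps HP]. unfold filtermap. destruct (Req_EM_T t t) as [_|]; [|easy].
    assert (He : 0 < eps / 2) by (apply Rdiv_lt_0_compat; [apply cond_pos|lra]).
    generalize (H t (fun Q HQ => HQ) (mkposreal _ He)).
    apply filter_imp. intros s Hs. apply HP.
    change (Rabs ((if Req_EM_T s t then l else (g s - g t) / (s - t)) - l) < eps)%R.
    destruct eps as [eps Hp]; simpl in *.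
    destruct (Req_EM_T s t) as [E|E].
    + rewrite Rminus_diag, Rabs_R0; lra.
    + change (Rabs ((g s - g t) - (s - t) * l) <= eps / 2 * Rabs (s - t))%R in Hs.
      replace ((g s - g t) / (s - t) - l)%R with (((g s - g t) - (s - t) * l) / (s - t))%R by (field; lra).
      assert (0 < Rabs (s - t)) by (apply Rabs_pos_lt; lra).
      rewrite Rabs_div by lra.
      apply Rle_lt_trans with (eps / 2); [|lra].
      apply Rle_div_l; lra.
  - destruct (Req_EM_T t t); easy.
  - intros s. destruct (Req_EM_T s t) as [->|E]; [ring|field; lra].
Qed.

Lemma is_derive_Re_comp F (gamma psi : R -> C) t d :
  Cderiv F (gamma t) d -> continuous psi t ->
  (forall s, gamma s - gamma t = psi s * RtoC (s - t))%C ->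
  is_derive (fun s => Re (F (gamma s))) t (Re (d * psi t)).
Proof.
  intros (p & Hp & <- & Ep) Hpsi Eg.
  assert (Hg : continuous gamma t).
  { apply continuous_ext with (f := fun s => (gamma t + psi s * RtoC (s - t))%C).
    - intros s. rewrite <- Eg. C_eq; ring.
    - apply continuous_Cplus; [apply continuous_const|].
      apply continuous_Cmult; auto. apply continuous_C_split; simpl.
      + apply (continuous_minus (V := R_NormedModule) (fun s => s) (fun _ => t)); [apply continuous_id|apply continuous_const].
      + apply continuous_const. }
  apply (is_derive_slope (fun s => Re (F (gamma s))) (fun s => Re (p (gamma s) * psi s))).
  - apply continuous_Re, continuous_Cmult; auto. now apply continuous_comp.
  - assert (Ep' : locally t (fun s => F (gamma s) - F (gamma t) = p (gamma s) * (gamma s - gamma t))%C)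
      by exact (Hg _ Ep).
    revert Ep'. apply filter_imp. intros s E.
    change (Re (F (gamma s)) - Re (F (gamma t)))%R with (Re (F (gamma s) - F (gamma t))).
    rewrite E, Eg. simpl. ring.
Qed.

Lemma is_derive_Re_line F c v t d :
  Cderiv F (c + RtoC t * v) d ->
  is_derive (fun s : R => Re (F (c + RtoC s * v)%C)) t (Re (d * v)).
Proof.
  intros H.
  apply (is_derive_Re_comp F (fun s => c + RtoC s * v)%C (fun _ => v) t d H).
  - apply continuous_const.
  - intros s. rewrite RtoC_minus. C_eq; ring.
Qed.

(** Mean value inequality on a segment: apply the real mean value theorem to the
    component of [E] in the direction of [E b - E a]. *)
Lemma Cderiv_segment_bound E E' a b K :
  (forall t, 0 <= t <= 1 -> Cderiv E (a + RtoC t * (b - a)) (E' (a + RtoC t * (b - a))%C)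
      /\ Cmod (E' (a + RtoC t * (b - a))%C) <= K) ->
  Cmod (E b - E a) <= K * Cmod (b - a).
Proof.
  intros H. set (v := (E b - E a)%C).
  pose (g := fun s : R => Re (Cconj v * E (a + RtoC s * (b - a))%C)).
  pose (dg := fun s : R => Re (Cconj v * E' (a + RtoC s * (b - a))%C * (b - a))).
  assert (Hd : forall s, 0 <= s <= 1 -> is_derive g s (dg s)).
  { intros s Hs. apply (is_derive_Re_line (fun z => Cconj v * E z)%C).
    replace (Cconj v * E' (a + s * (b - a))%C)%C with
      (0 * E (a + s * (b - a))%C + Cconj v * E' (a + s * (b - a))%C)%C by ring.
    apply (Cderiv_mult (fun _ => Cconj v) E); [apply Cderiv_const|now apply H]. }
  destruct (MVT_gen g 0 1 dg) as (s & Hs & Es).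
  - intros s. rewrite Rmin_left, Rmax_right by lra. intros; apply Hd; lra.
  - intros s. rewrite Rmin_left, Rmax_right by lra. intros Hs.
    apply continuity_pt_filterlim, (ex_derive_continuous (V := R_NormedModule)). eexists; now apply Hd.
  - rewrite Rmin_left, Rmax_right in Hs by lra.
    assert (Ev : (g 1 - g 0 = Cmod v ^ 2)%R).
    { unfold g. replace (a + 1 * (b - a))%C with b by ring.
      replace (a + 0 * (b - a))%C with a by ring.
      rewrite Cmod2_alt. unfold v. simpl. ring. }
    rewrite Ev in Es.
    assert (Hle : dg s <= Cmod v * (K * Cmod (b - a))).
    { eapply Rle_trans; [apply Rle_abs|]. eapply Rle_trans; [apply re_le_Cmod|].
      rewrite !Cmod_mult, Cmod_conj, Rmult_assoc.
      apply Rmult_le_compat_l; [apply Cmod_ge_0|].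
      apply Rmult_le_compat_r; [apply Cmod_ge_0|]. now apply H. }
    assert (H0 := H 0 ltac:(lra)). assert (HK : 0 <= K) by (eapply Rle_trans; [apply Cmod_ge_0|apply H0]).
    assert (Hb := Cmod_ge_0 (b - a)). assert (Hv := Cmod_ge_0 v).
    destruct (Req_dec (Cmod v) 0) as [Z|Z]; [rewrite Z; nra|].
    apply Rmult_le_reg_l with (Cmod v); nra.
Qed.

(** * Positive real part on circles *)

(** The point of argument [th] on the unit circle. *)
Definition expi (th : R) : C := (cos th, sin th).

Lemma Cmod_expi th : Cmod (expi th) = 1.
Proof.
  unfold Cmod, expi; simpl.
  rewrite !Rmult_1_r. fold (Rsqr (cos th)) (Rsqr (sin th)).
  rewrite Rplus_comm, sin2_cos2. apply sqrt_1.
Qed.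

Lemma Cmod_circle c t th : 0 < t -> Cmod (c + RtoC t * expi th - c) = t.
Proof.
  intros Ht. replace (c + t * expi th - c)%C with (RtoC t * expi th)%C by ring.
  rewrite Cmod_mult, Cmod_expi, Cmod_R, Rabs_pos_eq; lra.
Qed.

Lemma continuous_expi th : continuous expi th.
Proof.
  apply continuous_C_split; simpl.
  - apply (continuous_cos th).
  - apply (continuous_sin th).
Qed.

Lemma expi_slope th : exists psi : R -> C, continuous psi th /\ psi th = (Ci * expi th)%C /\
  forall s, (expi s - expi th = psi s * RtoC (s - th))%C.
Proof.
  destruct (slope_of_is_derive cos th (- sin th) (is_derive_cos th)) as (p & Hp & Ep & Sp).
  destruct (slope_of_is_derive sin th (cos th) (is_derive_sin th)) as (q & Hq & Eq & Sq).
  exists (fun s => (p s, q s)). repeat split.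
  - apply continuous_C_split; simpl; auto.
  - rewrite Ep, Eq. unfold expi, Ci, Cmult; simpl. f_equal; ring.
  - intros s. unfold expi, Cminus, Cmult, Cplus, Copp, RtoC; simpl. f_equal.
    + rewrite <- Rminus_def, Sp; ring.
    + rewrite <- Rminus_def, Sq; ring.
Qed.

Lemma continuous_polar c (x : R * R) :
  continuous (fun y : R * R => c + RtoC (fst y) * expi (snd y))%C x.
Proof.
  apply continuous_Cplus; [apply continuous_const|]. apply continuous_Cmult.
  - apply continuous_C_split; simpl; [apply continuous_fst|apply continuous_const].
  - apply (continuous_comp snd expi); [apply continuous_snd|apply continuous_expi].
Qed.

Lemma continuous_circle c t th :
  continuous (fun s : R => c + RtoC t * expi s)%C th.
Proof.
  apply continuous_Cplus; [apply continuous_const|]. apply continuous_Cmult.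
  - apply continuous_const.
  - apply continuous_expi.
Qed.

(** The integrand is the real part of [/ (i t)] times the derivative in [th] of the
    periodic function [F (c + t * expi th)]. *)
Lemma RInt_circle_derive (F F' : C -> C) c t : 0 < t ->
  (forall z, Cmod (z - c) = t -> Cderiv F z (F' z) /\ continuous F' z) ->
  RInt (fun th => Re (F' (c + RtoC t * expi th)%C * expi th)) 0 (2 * PI) = 0.
Proof.
  intros Ht HF.
  assert (Hm : forall th, Cmod (c + RtoC t * expi th - c) = t).
  { intros th. now apply Cmod_circle. }
  pose (g := fun s => Re (- Ci / RtoC t * F (c + RtoC t * expi s)%C)).
  assert (HI : is_RInt (fun th => Re (F' (c + RtoC t * expi th)%C * expi th)) 0 (2 * PI)
     (minus (g (2 * PI)) (g 0))).
  { apply (is_RInt_derive (V := R_CompleteNormedModule)).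
    - intros th _. destruct (expi_slope th) as (psi & Hc & Epsi & Hs).
      destruct (HF _ (Hm th)) as [Hd _].
      replace (F' (c + t * expi th) * expi th)%C with
        ((0 * F (c + t * expi th) + - Ci / RtoC t * F' (c + t * expi th)) * (t * psi th))%C.
      + apply (is_derive_Re_comp (fun z => - Ci / RtoC t * F z)%C
           (fun s => c + RtoC t * expi s)%C (fun s => RtoC t * psi s)%C th).
        * apply (Cderiv_mult (fun _ => - Ci / RtoC t)%C F); [apply Cderiv_const|exact Hd].
        * apply continuous_Cmult; auto using continuous_const.
        * intros s. replace (c + t * expi s - (c + t * expi th))%C with (t * (expi s - expi th))%C by ring.
          rewrite Hs. C_eq; ring.
      + rewrite Epsi.
        transitivity (- (Ci * Ci) * F' (c + t * expi th) * expi th)%C.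
        * field. intros E. apply (f_equal fst) in E; simpl in E; lra.
        * replace (Ci * Ci)%C with ((- (1))%C) by (unfold Ci, Cmult, Copp, RtoC; simpl; f_equal; ring).
          ring.
    - intros th _. apply continuous_Re, continuous_Cmult; [|apply continuous_expi].
      apply (continuous_comp (fun s => c + RtoC t * expi s)%C F'); [apply continuous_circle|].
      apply HF, Hm. }
  rewrite (is_RInt_unique _ _ _ _ HI).
  unfold g, expi. rewrite cos_2PI, sin_2PI, cos_0, sin_0. apply (minus_eq_zero (G := R_AbelianGroup)).
Qed.

(** Cauchy's theorem for circles: the mean of [Re F] over the circle of radius [t]
    about [c] does not depend on [t]. *)
Lemma RInt_circle_constant F c r t : holo (fun z => 0 < Cmod (z - c) < r) F ->
  0 < t < r ->
  is_derive (fun t => RInt (fun th => Re (F (c + RtoC t * expi th)%C)) 0 (2 * PI)) t 0.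
Proof.
  intros [F' HF] Ht.
  assert (Hm := Cmod_circle c).
  assert (Hd : forall s th, 0 < s < r ->
    is_derive (fun u => Re (F (c + RtoC u * expi th)%C)) s (Re (F' (c + RtoC s * expi th)%C * expi th))).
  { intros s th Hs. apply is_derive_Re_line. apply HF. rewrite Hm; lra. }
  assert (Hl : locally t (fun s => 0 < s < r)).
  { apply (open_and (fun s => 0 < s) (fun s => s < r)); [apply open_gt|apply open_lt|auto]. }
  assert (HR : is_derive (fun t => RInt (fun th => Re (F (c + RtoC t * expi th)%C)) 0 (2 * PI)) t
    (RInt (fun th => Derive (fun u => Re (F (c + RtoC u * expi th)%C)) t) 0 (2 * PI))).
  { apply is_derive_RInt_param.
    - revert Hl; apply filter_imp; intros s Hs th _. eexists; now apply Hd.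
    - intros th _. apply continuity_2d_pt_filterlim.
      apply (continuous_ext_loc (T := prod_UniformSpace R_UniformSpace R_UniformSpace) (U := R_UniformSpace)
        (fun y : R * R => Derive (fun u => Re (F (c + RtoC u * expi (snd y))%C)) (fst y))
        (fun y : R * R => Re (F' (c + RtoC (fst y) * expi (snd y))%C * expi (snd y))) (t, th)).
      + assert (Hl2 : locally (t, th) (fun y : R * R => 0 < fst y < r))
          by exact (continuous_fst t th _ Hl).
        revert Hl2; apply filter_imp; intros y Hy. symmetry.
        now apply is_derive_unique, Hd.
      + apply continuous_Re, continuous_Cmult.
        * apply (continuous_comp (fun y : R * R => c + RtoC (fst y) * expi (snd y))%C F').
          -- apply continuous_polar.
          -- apply HF; simpl. rewrite Hm; lra.
        * apply (continuous_comp snd expi); [apply continuous_snd|apply continuous_expi].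
    - revert Hl; apply filter_imp; intros s Hs.
      apply (ex_RInt_continuous (V := R_CompleteNormedModule)); intros th _.
      apply continuous_Re.
      apply (continuous_comp (fun th => c + RtoC s * expi th)%C F); [apply continuous_circle|].
      eapply Cderiv_continuous, HF. rewrite Hm; lra. }
  match type of HR with is_derive _ _ ?I => assert (E : I = 0) end; [|now rewrite E in HR].
  transitivity (RInt (fun th => Re (F' (c + RtoC t * expi th)%C * expi th)) 0 (2 * PI)).
  - apply RInt_ext. intros th _. now apply is_derive_unique, Hd.
  - apply (RInt_circle_derive F F'); [lra|]. intros z Hz; apply HF; lra.
Qed.

(** Minimum principle for [Re F], allowing a removable singularity at the centre. *)
Lemma circle_Re_nonneg F c r t L :
  holo (fun z => 0 < Cmod (z - c) < r) F -> 0 < t < r ->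
  filterlim F (locally' c) (locally L) ->
  (forall z, Cmod (z - c) = t -> 0 <= Re (F z)) -> 0 <= Re L.
Proof.
  intros HF Ht HL Hpos.
  assert (Hm := Cmod_circle c).
  set (A := fun t => RInt (fun th => Re (F (c + RtoC t * expi th)%C)) 0 (2 * PI)).
  assert (Hex : forall s, 0 < s < r -> ex_RInt (fun th => Re (F (c + RtoC s * expi th)%C)) 0 (2 * PI)).
  { intros s Hs. apply (ex_RInt_continuous (V := R_CompleteNormedModule)); intros th _.
    apply continuous_Re.
    apply (continuous_comp (fun th => c + RtoC s * expi th)%C F); [apply continuous_circle|].
    apply (holo_continuous _ _ _ HF). rewrite Hm; lra. }
  assert (HP := PI_RGT_0).
  assert (HA : 0 <= A t).
  { apply RInt_ge_0; [lra|now apply Hex|]. intros th _. apply Hpos, Hm; lra. }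
  apply Rnot_lt_le; intros Hneg.
  (* If [Re L < 0], then [Re F < 0] on all small circles, and so is its mean there. *)
  assert (HLe : locally' c (fun z => Re (F z) <= Re L / 2)).
  { assert (HLb : locally L (fun w => Re w <= Re L / 2)).
    { apply locally_Cmod. exists (- Re L / 2); split; [lra|]. intros w Hw.
      assert (Hr := re_le_Cmod (w - L)). apply Rabs_le_between in Hr.
      simpl in Hr; unfold Re in *; simpl in *. lra. }
    exact (HL _ HLb). }
  unfold locally', within in HLe. apply locally_Cmod in HLe as (d & Hd & HLe).
  set (s := Rmin (d / 2) (t / 2)).
  assert (Hs : 0 < s) by (apply Rmin_glb_lt; lra).
  assert (Hs1 : s <= d / 2) by apply Rmin_l. assert (Hs2 : s <= t / 2) by apply Rmin_r.
  assert (HAs : A s = A t).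
  { apply (eq_is_derive (V := R_NormedModule) A s t); [|lra]. intros u Hu.
    apply (RInt_circle_constant F c r); auto. lra. }
  assert (A s <= RInt (fun _ => Re L / 2) 0 (2 * PI)).
  { apply RInt_le; [lra|apply Hex; lra|apply ex_RInt_const|]. intros th _.
    apply HLe; rewrite ?Hm; try lra.
    intros E. assert (Hc := Hm s th Hs). rewrite E in Hc.
    rewrite Cmod_diag in Hc; lra. }
  rewrite RInt_const in H. unfold scal in H; simpl in H; unfold mult in H; simpl in H.
  nra.
Qed.

(** Gradient estimate for functions of nonnegative real part.  With [u] the conjugate
    of [d] and [t = r / 2], the lemma [circle_Re_nonneg] is applied to
    [G z = k q(z) - u (q(z) - q(c)) / (z - c) - conj u (z - c) (q(z) + conj (q c)) / t^2].
    On the circle [|z - c| = t] one has [1 / (z - c) = conj (z - c) / t^2], so the last two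
    terms have real part [- 2 Re (u conj (z - c)) Re (q z) / t^2], which
    [k = 2 |u| / t] dominates.  At the centre, [G] tends to [k q(c) - |d|^2]. *)
Lemma Re_pos_deriv_bound q c r d :
  0 < r -> holo (fun z => Cmod (z - c) < r) q ->
  (forall z, Cmod (z - c) < r -> 0 <= Re (q z)) ->
  Cderiv q c d -> Cmod d * r <= 4 * Re (q c).
Proof.
  intros HR Hq Hpos Hd.
  set (u := Cconj d). set (q0 := q c). set (t := (r / 2)%R).
  assert (Ht : 0 < t < r) by (unfold t; lra).
  set (k := (2 * Cmod u / t)%R).
  set (G := fun z => (RtoC k * q z + - (u * ((q z - q0) / (z - c)) +
                Cconj u * ((z - c) * (q z + Cconj q0)) / RtoC (t * t)))%C).
  assert (Htt : RtoC (t * t) <> 0%C).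
  { intros E; apply (f_equal fst) in E; simpl in E; nra. }
  assert (H0 : 0 <= Re (k * q0 + - (u * d))).
  { apply (circle_Re_nonneg G c r t); auto.
    - assert (Hq' : holo (fun z => 0 < Cmod (z - c) < r) q)
        by (revert Hq; apply holo_sub; intros; lra).
      assert (Hzc : holo (fun z => 0 < Cmod (z - c) < r) (fun z => z - c)%C)
        by (apply holo_plus; [apply holo_id|apply holo_const]).
      unfold G, Cdiv.
      C_holo; auto using holo_id.
      apply holo_inv; auto. intros z Hz. now apply Cmod_gt_0.
    (* Near [c], [G] agrees off the centre with the continuous function [G2]. *)
    - destruct Hd as (phi & Hphi & <- & Ephi).
      set (G2 := fun z => (RtoC k * q z + - (u * phi z +
                Cconj u * ((z - c) * (q z + Cconj q0)) * / RtoC (t * t)))%C).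
      assert (HG2 : continuous G2 c).
      { assert (Hqc : continuous q c).
        { apply (holo_continuous _ _ c Hq). rewrite Cmod_diag; lra. }
        unfold G2.
        C_cont; auto using continuous_id. }
      replace (k * q0 + - (u * phi c))%C with (G2 c) by (unfold G2; fold q0; ring).
      apply filterlim_ext_loc with (f := G2).
      + unfold locally', within. revert Ephi. apply filter_imp; intros z E Hz.
        unfold G2, G. unfold q0 at 2. rewrite E. C_eq. field. split; auto.
        intros Z; apply Hz. C_eq. replace z with ((z - c) + c)%C by (C_eq; ring).
        rewrite Z; C_eq; ring.
      + intros P HP. unfold filtermap, locally', within.
        generalize (HG2 P HP); unfold filtermap. apply filter_imp; auto.
    - intros z Hz.
      set (v := (u * Cconj (z - c))%C).
      assert (Hz0 : (z - c)%C <> 0%C) by (apply Cmod_gt_0; lra).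
      assert (Hzz : ((z - c) * Cconj (z - c))%C = RtoC (t * t)).
      { rewrite <- Cmod2_conj, Hz. f_equal; ring. }
      assert (EG : G z = (RtoC k * q z + - RtoC (/ (t * t)) * (v * (q z - q0) + Cconj v * (q z + Cconj q0)))%C).
      { unfold G, v. rewrite Cmult_conj, Cconj_conj.
        replace ((q z - q0) / (z - c))%C with (RtoC (/ (t * t)) * (Cconj (z - c) * (q z - q0)))%C.
        - rewrite RtoC_inv by nra. C_eq. field. auto.
        - rewrite RtoC_inv by nra. rewrite <- Hzz. C_eq. field. split; auto.
          intros Z. rewrite Z, Cmult_0_r in Hzz. now rewrite <- Hzz in Htt. }
      rewrite EG.
      assert (Hv : Re v <= Cmod u * t).
      { eapply Rle_trans; [apply Rle_abs|]. eapply Rle_trans; [apply re_le_Cmod|].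
        unfold v. rewrite Cmod_mult, Cmod_conj, Hz. lra. }
      replace (Re _) with ((k - / (t * t) * (2 * Re v)) * Re (q z))%R
        by (unfold RtoC, Cconj, Cminus, Cplus, Copp, Cmult, Re, Im; simpl; ring).
      apply Rmult_le_pos; [|apply Hpos; lra].
      replace k with (/ (t * t) * (2 * (Cmod u * t)))%R by (unfold k; field; lra).
      assert (0 < / (t * t)) by (apply Rinv_0_lt_compat; nra).
      nra. }
  assert (E : Re (k * q0 + - (u * d)) = (k * Re q0 - Cmod d ^ 2)%R).
  { rewrite Cmod2_alt. unfold u, RtoC, Cconj, Cplus, Copp, Cmult, Re, Im; simpl; ring. }
  rewrite E in H0. unfold k, u, t in H0. rewrite Cmod_conj in H0. fold q0.
  assert (Hd0 := Cmod_ge_0 d).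
  assert (Hq0 : 0 <= Re q0).
  { apply Hpos. rewrite Cmod_diag; lra. }
  destruct (Req_dec (Cmod d) 0) as [Z|Z]; [rewrite Z; lra|].
  apply Rmult_le_reg_l with (Cmod d / r)%R; [apply Rdiv_lt_0_compat; lra|].
  replace (Cmod d / r * (Cmod d * r))%R with (Cmod d ^ 2)%R by (field; lra).
  replace (Cmod d / r * (4 * Re q0))%R with (2 * Cmod d / (r / 2) * Re q0)%R by (field; lra).
  lra.
Qed.

(** * Oscillation and lower bounds *)

Lemma Cmod_segment c z s : 0 <= s <= 1 ->
  Cmod (c + RtoC s * (z - c) - c) <= Cmod (z - c).
Proof.
  intros Hs. replace (c + s * (z - c) - c)%C with (RtoC s * (z - c))%C by ring.
  rewrite Cmod_mult, Cmod_R, Rabs_pos_eq by lra.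
  assert (H := Cmod_ge_0 (z - c)). nra.
Qed.

(** Gronwall's inequality on [[0, 1]]. *)
Lemma gronwall_exp (g dg : R -> R) k :
  (forall s, 0 <= s <= 1 -> is_derive g s (dg s) /\ dg s <= k * g s) ->
  g 1 <= g 0 * exp k.
Proof.
  intros H.
  pose (h := fun s => (g s * exp (- k * s))%R).
  pose (dh := fun s => (dg s * exp (- k * s) + g s * (- k * exp (- k * s)))%R).
  assert (Hd : forall s, 0 <= s <= 1 -> is_derive h s (dh s)).
  { intros s Hs. destruct (H s Hs) as [Hg _].
    apply (is_derive_mult (K := R_AbsRing) g (fun s => exp (- k * s)) s (dg s) (- k * exp (- k * s)) Hg).
    - auto_derive; auto; ring.
    - apply Rmult_comm. }
  destruct (MVT_gen h 0 1 dh) as (s & Hs & Es).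
  - intros s. rewrite Rmin_left, Rmax_right by lra. intros; apply Hd; lra.
  - intros s. rewrite Rmin_left, Rmax_right by lra. intros Hs.
    apply continuity_pt_filterlim, (ex_derive_continuous (V := R_NormedModule)).
    eexists; now apply Hd.
  - rewrite Rmin_left, Rmax_right in Hs by lra.
    destruct (H s Hs) as [_ Hk].
    assert (He := exp_pos (- k * s)). unfold h, dh in Es.
    rewrite Rmult_0_r, exp_0 in Es.
    replace (- k * 1)%R with (- k)%R in Es by ring.
    assert (Hm : exp k * exp (- k) = 1) by (rewrite <- exp_plus, Rplus_opp_r; apply exp_0).
    assert (Hle : g 1 * exp (- k) <= g 0) by nra.
    assert (Hp := exp_pos k).
    replace (g 1) with (g 1 * exp (- k) * exp k)%R
      by (rewrite Rmult_assoc, (Rmult_comm (exp (- k))), Hm; ring).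
    apply Rmult_le_compat_r; lra.
Qed.

(** Harnack's inequality in the form needed below: by the gradient estimate [Re q]
    grows at most exponentially along segments, which bounds the derivative of [q],
    hence its oscillation, on a smaller disc.  The ratio [64] makes the oscillation at most
    [24 / 64 <= 1 / 2] of the value at the centre. *)
Lemma Re_pos_oscillation c r q z :
  0 < r -> holo (fun z => Cmod (z - c) < r) q ->
  (forall z, Cmod (z - c) < r -> 0 <= Re (q z)) ->
  Cmod (z - c) <= r / 64 -> Cmod (q z - q c) <= / 2 * Cmod (q c).
Proof.
  intros Hr Hq Hpos Hz. destruct (Hq) as [q' Hq'].
  assert (Hb : forall y, Cmod (y - c) <= r / 2 -> Cmod (q' y) * r <= 8 * Re (q y)).
  { intros y Hy.
    assert (Hin : forall w, Cmod (w - y) < r / 2 -> Cmod (w - c) < r).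
    { intros w Hw. replace (w - c)%C with ((w - y) + (y - c))%C by ring.
      eapply Rle_lt_trans; [apply Cmod_triangle|lra]. }
    assert (H := Re_pos_deriv_bound q y (r / 2) (q' y)).
    assert (Cmod (q' y) * (r / 2) <= 4 * Re (q y)); [|lra].
    apply H; [lra| |auto|apply Hq'; lra].
    revert Hq; apply holo_sub; auto. }
  assert (Hc := Cmod_ge_0 (z - c)).
  assert (HH : forall y, Cmod (y - c) <= r / 64 -> Re (q y) <= 3 * Re (q c)).
  { intros y Hy. assert (Hyc := Cmod_ge_0 (y - c)).
    assert (Hg : Re (q (c + 1 * (y - c))%C) <= Re (q (c + 0 * (y - c))%C) * exp (/ 8)).
    { apply (gronwall_exp (fun s => Re (q (c + RtoC s * (y - c))%C))
        (fun s => Re (q' (c + RtoC s * (y - c))%C * (y - c)))).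
      intros s Hs. assert (Hsy := Cmod_segment c y s Hs). split.
      - apply is_derive_Re_line, Hq'. lra.
      - set (w := (c + s * (y - c))%C) in *.
        eapply Rle_trans; [apply Rle_abs|]. eapply Rle_trans; [apply re_le_Cmod|].
        rewrite Cmod_mult. assert (Hw := Hb w ltac:(lra)).
        assert (Cmod (q' w) * Cmod (y - c) <= Cmod (q' w) * (r / 64)); [|lra].
        apply Rmult_le_compat_l; [apply Cmod_ge_0|lra]. }
    replace (c + 1 * (y - c))%C with y in Hg by ring.
    replace (c + 0 * (y - c))%C with c in Hg by ring.
    assert (He : exp (/ 8) <= 3).
    { eapply Rle_trans; [|apply exp_le_3]. left; apply exp_increasing; lra. }
    assert (0 <= Re (q c)).
    { apply Hpos. rewrite Cmod_diag; lra. }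
    nra. }
  assert (HL : Cmod (q z - q c) <= 24 * Re (q c) / r * Cmod (z - c)).
  { apply (Cderiv_segment_bound q q'). intros s Hs.
    assert (Hsy := Cmod_segment c z s Hs). split; [apply Hq'; lra|].
    apply Rle_div_r; [lra|]. eapply Rle_trans; [apply Hb; lra|].
    assert (H := HH (c + s * (z - c))%C ltac:(lra)). lra. }
  assert (H1 : 24 * Re (q c) / r * Cmod (z - c) <= 24 * Re (q c) / r * (r / 64)).
  { apply Rmult_le_compat_l; [|lra]. apply Rmult_le_pos.
    - assert (0 <= Re (q c)); [|lra].
      apply Hpos. rewrite Cmod_diag; lra.
    - left; now apply Rinv_0_lt_compat. }
  replace (24 * Re (q c) / r * (r / 64))%R with (3 / 8 * Re (q c))%R in H1 by (field; lra).
  assert (H2 := re_le_Cmod (q c)). assert (H3 := Rle_abs (Re (q c))).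
  assert (H4 := Cmod_ge_0 (q c)). lra.
Qed.
Lemma cauchy_seq_lim (z : nat -> C) K :
  (forall n, Cmod (z (S n) - z n) <= K * (/ 2) ^ n) ->
  exists l, filterlim z eventually (locally l).
Proof.
  intros H.
  assert (Hs : ex_series (V := C_NormedModule) (fun n => z (S n) - z n)%C).
  { apply (ex_series_le (V := C_CompleteNormedModule) _ (fun n => K * (/ 2) ^ n)%R).
    - intros n. change (Cmod (z (S n) - z n) <= K * (/ 2) ^ n). apply H.
    - apply (ex_series_scal (V := R_NormedModule) K (fun n => (/ 2) ^ n)). apply ex_series_geom.
      rewrite Rabs_pos_eq; lra. }
  destruct Hs as [l Hl].
  assert (Hsum : forall n, sum_n (G := C_AbelianMonoid) (fun n => z (S n) - z n)%C n = (z (S n) - z O)%C).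
  { induction n.
    - now rewrite sum_O.
    - rewrite sum_Sn, IHn. unfold plus; simpl. C_eq. ring. }
  exists (l + z O)%C.
  intros P HP. apply locally_Cmod in HP as (d & Hd & HP).
  assert (HL : eventually (fun n => Cmod (sum_n (G := C_AbelianMonoid) (fun n => z (S n) - z n)%C n - l) < d)).
  { apply (Hl (fun w => Cmod (w - l) < d)). apply locally_Cmod. exists d; auto. }
  destruct HL as [N HN]. exists (S N). intros n Hn.
  destruct n as [|n]; [lia|]. apply HP.
  assert (H1 := HN n ltac:(lia)). rewrite Hsum in H1.
  replace (z (S n) - (l + z O))%C with (z (S n) - z O - l)%C by ring. exact H1.
Qed.

(** Simplified Newton iteration [z - W z / W' c], started at [c]: where [W'] stays
    within [|W' c| / 2] of [W' c], each step halves [|W|], so that if [W c] is small enough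
    the iterates stay in the disc and converge to a zero of [W]. *)
Lemma newton_zero (W W' : C -> C) c rho :
  W' c <> 0%C -> 0 < rho ->
  (forall z, Cmod (z - c) < rho ->
     Cderiv W z (W' z) /\ Cmod (W' z - W' c) <= / 2 * Cmod (W' c)) ->
  2 * Cmod (W c) < rho * Cmod (W' c) ->
  exists z, Cmod (z - c) < rho /\ W z = 0%C.
Proof.
  intros Hne Hrho HW Hsmall.
  set (a := W' c) in *.
  assert (Ha : 0 < Cmod a) by now apply Cmod_gt_0.
  set (T := fun z => (z - W z / a)%C).
  set (zn := fix zn n := match n with O => c | S m => T (zn m) end).
  set (B := (Cmod (W c) / Cmod a)%R).
  assert (HB : 0 <= B) by (apply Rdiv_le_0_compat; [apply Cmod_ge_0|lra]).
  assert (HB2 : 2 * B < rho).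
  { unfold B. apply Rmult_lt_reg_r with (Cmod a); auto.
    replace (2 * (Cmod (W c) / Cmod a) * Cmod a)%R with (2 * Cmod (W c))%R by (field; lra). lra. }
  assert (HWB : Cmod (W c) = Cmod a * B) by (unfold B; field; lra).
  (* The nonlinear part [W z - a z] is Lipschitz with constant [|a| / 2], because its
     derivative is [W' z - W' c]. *)
  assert (Hcontr : forall x y, Cmod (x - c) < rho -> Cmod (y - c) < rho ->
     Cmod ((W y - a * y) - (W x - a * x)) <= / 2 * Cmod a * Cmod (y - x)).
  { intros x y Hx Hy.
    apply (Cderiv_segment_bound (fun z => W z + - (a * z))%C (fun z => W' z + - (0 * z + a * 1))%C).
    intros t Ht.
    assert (Hin : Cmod (x + t * (y - x) - c) < rho).
    { replace (x + t * (y - x) - c)%C with (RtoC (1 - t) * (x - c) + RtoC t * (y - c))%C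
        by (rewrite RtoC_minus; ring).
      eapply Rle_lt_trans; [apply Cmod_triangle|].
      rewrite !Cmod_mult, !Cmod_R, !Rabs_pos_eq by lra.
      assert (H1 := Cmod_ge_0 (x - c)). assert (H2 := Cmod_ge_0 (y - c)).
      destruct (Req_dec t 0) as [->|Z]; [lra|].
      assert (t * Cmod (y - c) < t * rho) by (apply Rmult_lt_compat_l; lra).
      assert ((1 - t) * Cmod (x - c) <= (1 - t) * rho) by (apply Rmult_le_compat_l; lra).
      lra. }
    destruct (HW _ Hin) as [Hd Hm]. split.
    - apply Cderiv_plus; auto. apply Cderiv_opp.
      apply (Cderiv_mult (fun _ => a) (fun z => z)); [apply Cderiv_const|apply Cderiv_id].
    - replace (W' (x + t * (y - x)) + - (0 * (x + t * (y - x)) + a * 1))%C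
        with (W' (x + t * (y - x)) - a)%C by ring. exact Hm. }
  assert (Hstep : forall n, Cmod (zn n - c) <= 2 * B * (1 - (/ 2) ^ n) /\
                  Cmod (W (zn n)) <= Cmod a * B * (/ 2) ^ n).
  { assert (Hp : forall n, 0 < (/ 2) ^ n) by (intros n; apply pow_lt; lra).
    induction n as [|n [IH1 IH2]].
    - simpl. rewrite Cmod_diag, HWB; lra.
    - assert (Hpn := Hp n).
      assert (Hd : Cmod (zn (S n) - zn n) <= B * (/ 2) ^ n).
      { simpl. unfold T. replace (zn n - W (zn n) / a - zn n)%C with (- (W (zn n) / a))%C by (field; auto).
        rewrite Cmod_opp, Cmod_div by auto. apply Rle_div_l; lra. }
      assert (H1 : Cmod (zn (S n) - c) <= 2 * B * (1 - (/ 2) ^ S n)).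
      { replace (zn (S n) - c)%C with ((zn (S n) - zn n) + (zn n - c))%C by ring.
        eapply Rle_trans; [apply Cmod_triangle|]. rewrite <- tech_pow_Rmult. lra. }
      split; auto.
      assert (Hpn' := Hp (S n)).
      assert (E : W (zn (S n)) = ((W (zn (S n)) - a * zn (S n)) - (W (zn n) - a * zn n))%C).
      { simpl. unfold T at 3. field; auto. }
      rewrite E. eapply Rle_trans; [apply Hcontr; nra|].
      rewrite <- tech_pow_Rmult. nra. }
  destruct (cauchy_seq_lim zn B) as [l Hl].
  { intros n. simpl. unfold T. replace (zn n - W (zn n) / a - zn n)%C with (- (W (zn n) / a))%C by (field; auto).
    rewrite Cmod_opp, Cmod_div by auto. destruct (Hstep n) as [_ H]. apply Rle_div_l; lra. }
  (* The iterates stay within [2 B < rho] of [c], hence so does their limit. *)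
  assert (Hlin : Cmod (l - c) < rho).
  { apply Rnot_le_lt; intros Hge.
    assert (He : eventually (fun n => Cmod (zn n - l) < rho - 2 * B)).
    { apply (Hl (fun w => Cmod (w - l) < rho - 2 * B)). apply locally_Cmod.
      exists (rho - 2 * B)%R; split; auto; lra. }
    destruct He as [N HN]. assert (H1 := HN N (le_n _)). destruct (Hstep N) as [H2 _].
    assert (Hp : 0 < (/ 2) ^ N) by (apply pow_lt; lra).
    assert (Cmod (l - c) <= Cmod (zn N - l) + Cmod (zn N - c)); [|nra].
    replace (l - c)%C with (- (zn N - l) + (zn N - c))%C by ring.
    eapply Rle_trans; [apply Cmod_triangle|]. rewrite Cmod_opp; lra. }
  exists l; split; auto.
  destruct (HW l Hlin) as [Hd _]. apply Cderiv_continuous in Hd.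
  apply Cmod_eq_0. apply Rle_antisym; [|apply Cmod_ge_0].
  apply Rnot_lt_le; intros Hgt.
  assert (He : eventually (fun n => Cmod (W (zn n) - W l) < Cmod (W l) / 2)).
  { apply (filterlim_comp _ _ _ zn W eventually (locally l) (locally (W l)) Hl Hd (fun w => Cmod (w - W l) < Cmod (W l) / 2)).
    apply locally_Cmod. exists (Cmod (W l) / 2)%R; split; auto; lra. }
  destruct He as [N HN].
  assert (HAB : 0 <= Cmod a * B) by nra.
  destruct (pow_lt_1_zero (/ 2) ltac:(rewrite Rabs_pos_eq; lra) (Cmod (W l) / 2 / (Cmod a * B + 1))%R) as [M HM].
  { apply Rdiv_lt_0_compat; lra. }
  set (n := max N M). assert (H1 := HN n ltac:(lia)). assert (H2 := HM n ltac:(lia)).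
  assert (Hp : 0 < (/ 2) ^ n) by (apply pow_lt; lra).
  rewrite Rabs_pos_eq in H2 by lra.
  apply Rlt_div_r in H2; [|lra].
  destruct (Hstep n) as [_ H3].
  assert (Cmod (W l) <= Cmod (W (zn n) - W l) + Cmod (W (zn n))); [|nra].
  replace (W l)%C with (- (W (zn n) - W l) + W (zn n))%C at 1 by ring.
  eapply Rle_trans; [apply Cmod_triangle|]. rewrite Cmod_opp; lra.
Qed.

(** A lower bound of Koebe type: a function without zeros whose derivative has
    nonnegative real part on a disc cannot be small at the centre compared with its
    derivative there. *)
Lemma nonvanishing_lower_bound (W q : C -> C) c r :
  0 < r -> holo (fun z => Cmod (z - c) < r) q ->
  (forall z, Cmod (z - c) < r -> 0 <= Re (q z)) ->
  (forall z, Cmod (z - c) < r -> Cderiv W z (q z) /\ W z <> 0%C) ->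
  Cmod (q c) * r <= 128 * Cmod (W c).
Proof.
  intros Hr Hq Hpos HW.
  destruct (Ceq_dec (q c) 0) as [E|E].
  - rewrite E, Cmod_0. assert (H := Cmod_ge_0 (W c)). lra.
  - apply Rnot_lt_le; intros Hlt.
    destruct (newton_zero W q c (r / 64)) as (z & Hz & E0); auto; try lra.
    + intros z Hz. split; [apply HW; lra|]. apply (Re_pos_oscillation c r); auto; lra.
    + apply (HW z); auto; lra.
Qed.

(** * Differentiability of analytic functions *)

Lemma Cderiv_of_quadratic F z d K rho :
  0 < rho ->
  (forall y, Cmod (y - z) < rho -> Cmod (F y - F z - d * (y - z)) <= K * Cmod (y - z) ^ 2) ->
  Cderiv F z d.
Proof.
  intros Hrho H.
  exists (fun y => if Ceq_dec y z then d else ((F y - F z) / (y - z))%C).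
  repeat split.
  - apply continuous_Cmod_lt. intros eps He. apply locally_Cmod.
    assert (HK := Rabs_pos K).
    assert (Hq : 0 < eps / (Rabs K + 1)) by (apply Rdiv_lt_0_compat; lra).
    exists (Rmin rho (eps / (Rabs K + 1))). split; [now apply Rmin_glb_lt|].
    intros y Hy. assert (Hy1 := Rlt_le_trans _ _ _ Hy (Rmin_l _ _)).
    assert (Hy2 := Rlt_le_trans _ _ _ Hy (Rmin_r _ _)).
    destruct (Ceq_dec z z) as [_|]; [|easy].
    destruct (Ceq_dec y z) as [->|E].
    + rewrite Cmod_diag; lra.
    + assert (Hyz : (y - z)%C <> 0%C).
      { intros Z. apply E. replace y with ((y - z) + z)%C by ring. rewrite Z; ring. }
      replace ((F y - F z) / (y - z) - d)%C with ((F y - F z - d * (y - z)) / (y - z))%C by (field; auto).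
      rewrite Cmod_div by auto. apply Cmod_gt_0 in Hyz.
      apply Rlt_div_l; [lra|].
      apply Rlt_div_r in Hy2; [|lra].
      eapply Rle_lt_trans; [now apply H|].
      assert (HK2 := Rle_abs K). simpl. rewrite Rmult_1_r, <- Rmult_assoc.
      apply Rmult_lt_compat_r; [lra|]. nra.
  - destruct (Ceq_dec z z); easy.
  - apply filter_forall. intros y. destruct (Ceq_dec y z) as [->|E]; C_eq; [ring|].
    field. intros Z. apply E. replace y with ((y - z) + z)%C by (C_eq; ring). rewrite Z; C_eq; ring.
Qed.

Lemma is_series_Cmod_le (a : nat -> C) (b : nat -> R) l B :
  is_series (V := C_NormedModule) a l -> is_series b B ->
  (forall n, Cmod (a n) <= b n) -> Cmod l <= B.
Proof.
  intros Ha Hb Hab.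
  apply (is_lim_seq_le (fun n => norm (V := C_NormedModule) (sum_n a n)) (sum_n b) (Cmod l) B).
  - intros n. unfold sum_n. eapply Rle_trans; [apply (norm_sum_n_m (V := C_NormedModule))|].
    apply sum_n_m_le, Hab.
  - apply (filterlim_comp _ _ _ (sum_n a) (norm (V := C_NormedModule)) eventually (locally l)); [exact Ha|].
    apply (filterlim_norm (V := C_NormedModule) l).
  - exact Hb.
Qed.

Lemma is_series_Cmod_bounded (a : nat -> C) l :
  is_series (V := C_NormedModule) a l -> exists M, forall n, Cmod (a n) <= M.
Proof.
  intros H.
  destruct (filterlim_bounded (V := C_NormedModule) (sum_n a)) as [M HM]; [now exists l|].
  exists (2 * M)%R. intros n.
  assert (H0 := HM O). assert (Hn0 := norm_ge_0 (V := C_NormedModule) (sum_n a O)).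
  destruct n as [|n].
  - rewrite sum_O in *. change (norm (V := C_NormedModule) (a O) <= 2 * M). lra.
  - replace (a (S n)) with (sum_n (G := C_AbelianMonoid) a (S n) - sum_n (G := C_AbelianMonoid) a n)%C.
    + unfold Cminus. eapply Rle_trans; [apply Cmod_triangle|]. rewrite Cmod_opp.
      assert (H1 := HM n). assert (H2 := HM (S n)).
      change (norm (V := C_NormedModule) (sum_n a (S n)) + norm (V := C_NormedModule) (sum_n a n) <= 2 * M). lra.
    + rewrite sum_Sn. unfold plus; simpl. C_eq. ring.
Qed.

Lemma Cpow_n (x : C) n : pow_n (K := C_Ring) x n = (x ^ n)%C.
Proof.
  induction n as [|n IH]; [reflexivity|].
  simpl. unfold mult; simpl. now rewrite IH.
Qed.

Lemma INR_le_pow4 n : INR n <= 4 ^ n.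
Proof.
  induction n as [|n IH]; [simpl; lra|].
  rewrite S_INR. simpl. assert (1 <= 4 ^ n) by (apply pow_R1_Rle; lra). lra.
Qed.

Lemma Cmod_pow_le x rho n : Cmod x <= rho -> Cmod (x ^ n)%C <= rho ^ n.
Proof.
  intros H. rewrite Cmod_pow. apply pow_incr. split; [apply Cmod_ge_0|auto].
Qed.

(** A crude bound for the first-order Taylor remainder of the powers; the factor
    [4 ^ n] is absorbed by shrinking the radius of convergence. *)
Lemma Cpow_taylor_bound x y rho n : Cmod x <= rho -> Cmod y <= rho -> 
  Cmod (y ^ n - x ^ n - INR n * x ^ pred n * (y - x)) * rho ^ 2 <= (4 * rho) ^ n * Cmod (y - x) ^ 2.
Proof.
  intros Hx Hy. assert (Hrho : 0 <= rho) by (eapply Rle_trans; [apply Cmod_ge_0|apply Hx]).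
  induction n as [|n IH].
  - simpl INR. replace (y ^ 0 - x ^ 0 - 0 * x ^ pred 0 * (y - x))%C with (RtoC 0) by (simpl; ring).
    rewrite Cmod_0. simpl. assert (H := Cmod_ge_0 (y - x)). nra.
  - assert (E : (y ^ S n - x ^ S n - INR (S n) * x ^ pred (S n) * (y - x) =
      y * (y ^ n - x ^ n - INR n * x ^ pred n * (y - x)) + INR n * x ^ pred n * ((y - x) * (y - x)))%C).
    { rewrite S_INR, RtoC_plus. destruct n as [|n]; simpl pred; simpl Cpow; [simpl INR|]; ring. }
    rewrite E. set (D := (y ^ n - x ^ n - INR n * x ^ pred n * (y - x))%C) in *.
    set (m := Cmod (y - x)) in *.
    assert (H2 : Cmod (INR n * x ^ pred n * ((y - x) * (y - x))) * rho ^ 2 <= 4 ^ n * rho ^ S n * m ^ 2).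
    { rewrite !Cmod_mult, Cmod_R, (Rabs_pos_eq _ (pos_INR n)). fold m.
      destruct n as [|n].
      - simpl. rewrite !Rmult_0_l. apply Rmult_le_pos; [lra|apply pow2_ge_0].
      - change (pred (S n)) with n. assert (H := Cmod_pow_le x rho n Hx).
        assert (H4 := INR_le_pow4 (S n)). assert (H0 := Cmod_ge_0 (x ^ n)).
        assert (Hi := pos_INR (S n)).
        replace (INR (S n) * Cmod (x ^ n) * (m * m) * rho ^ 2)%R with
          ((INR (S n) * Cmod (x ^ n)) * (rho ^ 2 * m ^ 2))%R by ring.
        replace (4 ^ S n * rho ^ S (S n) * m ^ 2)%R with
          ((4 ^ S n * rho ^ n) * (rho ^ 2 * m ^ 2))%R by (simpl; ring).
        apply Rmult_le_compat_r; [apply Rmult_le_pos; apply pow2_ge_0|].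
        apply Rmult_le_compat; auto. }
    assert (H1 : Cmod (y * D) * rho ^ 2 <= rho * ((4 * rho) ^ n * m ^ 2)).
    { rewrite Cmod_mult, Rmult_assoc. apply Rmult_le_compat; auto using Cmod_ge_0.
      apply Rmult_le_pos; [apply Cmod_ge_0|apply pow2_ge_0]. }
    eapply Rle_trans; [apply Rmult_le_compat_r; [apply pow2_ge_0|apply Cmod_triangle]|].
    rewrite Rmult_plus_distr_r.
    assert (Hp : 0 <= 4 ^ n * rho ^ S n * m ^ 2).
    { apply Rmult_le_pos; [apply Rmult_le_pos; apply pow_le; lra|apply pow2_ge_0]. }
    rewrite !Rpow_mult_distr in *. simpl pow in *. nra.
Qed.

(** Term-by-term differentiation of power series, on the disc of radius [r / 16].
    At radius [8 rho = r / 2] the terms are bounded by some [M]; at radius [4 rho] they are then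
    dominated by a geometric series, which controls both the differentiated series and
    the Taylor remainders. *)
Lemma analytic_at_C_derive f z0 :
  analytic_at f z0 ->
  analytic_at (C_derive f) z0 /\
  exists rho, 0 < rho /\ forall z, Cmod (z - z0) < rho -> Cderiv f z (C_derive f z).
Proof.
  intros (a & r & Hr & Hf).
  assert (Hf' : forall z, Cmod (z - z0) < r -> is_series (V := C_NormedModule) (fun n => a n * (z - z0) ^ n)%C (f z)).
  { intros z Hz. apply is_series_ext with (2 := Hf z Hz). intros n.
    rewrite Cpow_n. unfold scal; simpl. unfold mult; simpl. C_eq. ring. }
  set (rho := (r / 16)%R).
  assert (HM : exists M, forall n, Cmod (a n) * (8 * rho) ^ n <= M).
  { destruct (is_series_Cmod_bounded _ _ (Hf' (z0 + RtoC (8 * rho))%C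
      ltac:(replace (z0 + RtoC (8 * rho) - z0)%C with (RtoC (8 * rho)) by ring;
        rewrite Cmod_R, Rabs_pos_eq; unfold rho; lra))) as [M HM].
    exists M. intros n. specialize (HM n).
    replace (z0 + RtoC (8 * rho) - z0)%C with (RtoC (8 * rho)) in HM by ring.
    rewrite Cmod_mult, Cmod_pow, Cmod_R, Rabs_pos_eq in HM by (unfold rho; lra). exact HM. }
  destruct HM as [M HM].
  assert (Hrho : 0 < rho) by (unfold rho; lra).
  assert (HM4 : forall n, Cmod (a n) * (4 * rho) ^ n <= M * (/ 2) ^ n).
  { intros n. replace (4 * rho)%R with (8 * rho * / 2)%R by lra.
    rewrite Rpow_mult_distr, <- Rmult_assoc. apply Rmult_le_compat_r; [apply pow_le; lra|auto]. }
  assert (Hgeom : forall k, is_series (fun n => k * (/ 2) ^ n)%R (k * 2)%R).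
  { intros k. apply (is_series_scal (V := R_NormedModule) k (fun n => (/ 2) ^ n)%R).
    assert (Hg := is_series_geom (/ 2) ltac:(rewrite Rabs_pos_eq; lra)).
    now replace (/ (1 - / 2))%R with 2%R in Hg by field. }
  set (dt := fun z n => (INR n * a n * (z - z0) ^ pred n)%C).
  assert (Hdt : forall z, Cmod (z - z0) < rho -> exists l : C, is_series (V := C_NormedModule) (dt z) l).
  { intros z Hz. apply (ex_series_le (V := C_CompleteNormedModule) _ (fun n => (M / rho) * (/ 2) ^ n)%R).
    - intros n. change (Cmod (dt z n) <= M / rho * (/ 2) ^ n). unfold dt.
      rewrite !Cmod_mult, Cmod_R, (Rabs_pos_eq _ (pos_INR n)).
      replace (M / rho * (/ 2) ^ n)%R with (M * (/ 2) ^ n / rho)%R by (field; lra).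
      apply (proj1 (Rle_div_r _ _ _ Hrho)). eapply Rle_trans; [|apply HM4].
      destruct n as [|n]; [simpl; rewrite !Rmult_0_l; assert (H := Cmod_ge_0 (a O)); lra|].
      change (pred (S n)) with n.
      rewrite Rpow_mult_distr. assert (H := Cmod_pow_le (z - z0) rho n ltac:(lra)).
      assert (H4 := INR_le_pow4 (S n)). assert (Hi := pos_INR (S n)).
      replace (INR (S n) * Cmod (a (S n)) * Cmod ((z - z0) ^ n) * rho)%R with
        (Cmod (a (S n)) * (INR (S n) * (Cmod ((z - z0) ^ n) * rho)))%R by ring.
      apply Rmult_le_compat_l; [apply Cmod_ge_0|].
      apply Rmult_le_compat; auto.
      + apply Rmult_le_pos; [apply Cmod_ge_0|lra].
      + simpl pow. rewrite Rmult_comm. apply Rmult_le_compat_l; lra.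
    - eexists; apply Hgeom. }
  assert (HC : forall (z l : C), Cmod (z - z0) < rho -> is_series (V := C_NormedModule) (dt z) l -> Cderiv f z l).
  { intros z l Hz Hl.
    apply (Cderiv_of_quadratic f z l (M / rho ^ 2 * 2) (rho - Cmod (z - z0))); [lra|].
    intros y Hy.
    assert (Hy' : Cmod (y - z0) < rho).
    { replace (y - z0)%C with ((y - z) + (z - z0))%C by ring.
      eapply Rle_lt_trans; [apply Cmod_triangle|lra]. }
    set (m := Cmod (y - z)).
    replace (M / rho ^ 2 * 2 * m ^ 2)%R with (M / rho ^ 2 * m ^ 2 * 2)%R by ring.
    apply (is_series_Cmod_le
      (fun n => a n * (y - z0) ^ n - a n * (z - z0) ^ n - (y - z) * dt z n)%C
      (fun n => M / rho ^ 2 * m ^ 2 * (/ 2) ^ n)%R).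
    - rewrite (Cmult_comm l).
      apply (is_series_minus (V := C_NormedModule)
        (fun n => a n * (y - z0) ^ n - a n * (z - z0) ^ n)%C (fun n => (y - z) * dt z n)%C).
      + apply (is_series_minus (V := C_NormedModule)
        (fun n => a n * (y - z0) ^ n)%C (fun n => a n * (z - z0) ^ n)%C); apply Hf'; unfold rho in *; lra.
      + apply (is_series_scal (V := C_NormedModule) (y - z)%C (dt z) l Hl).
    - apply Hgeom.
    - intros n. unfold dt.
      replace (a n * (y - z0) ^ n - a n * (z - z0) ^ n - (y - z) * (INR n * a n * (z - z0) ^ pred n))%C
        with (a n * ((y - z0) ^ n - (z - z0) ^ n - INR n * (z - z0) ^ pred n * ((y - z0) - (z - z0))))%C by ring.
      assert (HT := Cpow_taylor_bound (z - z0) (y - z0) rho n ltac:(lra) ltac:(lra)).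
      replace (y - z0 - (z - z0))%C with (y - z)%C in * by ring. fold m in HT.
      rewrite Cmod_mult. set (D := Cmod _) in HT |- *.
      assert (Hr2 : 0 < rho ^ 2) by (apply pow_lt; auto).
      replace (M / rho ^ 2 * m ^ 2 * (/ 2) ^ n)%R with (M * (/ 2) ^ n * m ^ 2 / rho ^ 2)%R by (field; lra).
      apply (proj1 (Rle_div_r _ _ _ Hr2)).
      apply Rle_trans with (Cmod (a n) * (4 * rho) ^ n * m ^ 2)%R.
      + rewrite !Rmult_assoc. apply Rmult_le_compat_l; [apply Cmod_ge_0|exact HT].
      + apply Rmult_le_compat_r; [apply pow2_ge_0|apply HM4]. }
  split.
  - exists (fun n => INR (S n) * a (S n))%C, rho. split; auto. intros z Hz.
    destruct (Hdt z Hz) as [l Hl].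
    rewrite (Cderiv_C_derive _ _ _ (HC z l Hz Hl)).
    apply is_series_ext with (a := fun n => dt z (S n)).
    + intros n. rewrite Cpow_n. unfold dt, scal; simpl pred. unfold scal; simpl. unfold mult; simpl. C_eq. ring.
    + apply (is_series_incr_1 (V := C_NormedModule)).
      match goal with |- is_series _ ?s => replace s with l; [exact Hl|] end.
      unfold dt. simpl. unfold plus; simpl. C_eq. ring.
  - exists rho. split; auto. intros z Hz. destruct (Hdt z Hz) as [l Hl].
    assert (H := HC z l Hz Hl). now rewrite (Cderiv_C_derive _ _ _ H).
Qed.

Lemma analytic_on_disc_derive f : analytic_on_disc f ->
  analytic_on_disc (C_derive f) /\ forall z, in_disc z -> Cderiv f z (C_derive f z).
Proof.
  intros H. split; intros z Hz; destruct (analytic_at_C_derive f z (H z Hz)) as [H1 (rho & Hrho & H2)]; auto.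
  apply H2. now rewrite Cmod_diag.
Qed.

(** * The reciprocal function in the exterior disc *)

Lemma Cmod_inv_exterior (zeta : C) : 1 < Cmod zeta ->
  zeta <> 0%C /\ in_disc (/ zeta) /\ (/ zeta)%C <> 0%C.
Proof.
  intros H. assert (H0 : zeta <> 0%C) by (apply Cmod_gt_0; lra).
  split; [auto|]. split.
  - unfold in_disc. rewrite Cmod_inv by auto.
    rewrite <- Rinv_1. apply Rinv_lt_contravar; lra.
  - apply Cmod_gt_0. rewrite Cmod_inv by auto. apply Rinv_0_lt_compat; lra.
Qed.

Lemma disc_in_exterior (c w : C) : Cmod (w - c) < Cmod c - 1 -> 1 < Cmod w.
Proof.
  intros H. assert (Cmod c <= Cmod (w - c) + Cmod w); [|lra].
  replace c with (- (w - c) + w)%C at 1 by ring.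
  eapply Rle_trans; [apply Cmod_triangle|]. rewrite Cmod_opp; lra.
Qed.

Section Exterior.
Variable f : C -> C.
Hypothesis Hf : analytic_on_disc f.
Hypothesis Hne : forall z, in_disc z -> z <> 0%C -> f z <> 0%C.
Hypothesis Hpos : forall z, in_disc z -> z <> 0%C ->
  0 < Re ((z / f z) ^ 2 * C_derive f z)%C.

(** The function [1 / f (1 / zeta)] on the exterior of the unit disc. *)
Definition recip_ext (zeta : C) : C := (/ f (/ zeta))%C.

(** Its derivative, written as a value of [(z / f z) ^ 2 * f' z] at [z = 1 / zeta]. *)
Definition deriv_ext (zeta : C) : C :=
  (C_derive f (/ zeta) * (/ zeta * / zeta) * / (f (/ zeta) * f (/ zeta)))%C.

Lemma holo_disc_C_derive : holo in_disc (C_derive f).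
Proof.
  exists (C_derive (C_derive f)).
  destruct (analytic_on_disc_derive f Hf) as [H1 _].
  destruct (analytic_on_disc_derive _ H1) as [H2 D1].
  destruct (analytic_on_disc_derive _ H2) as [_ D2].
  intros z Hz. split; [auto|]. eapply Cderiv_continuous; auto.
Qed.

Lemma holo_disc_analytic : holo in_disc f.
Proof.
  exists (C_derive f). destruct (analytic_on_disc_derive f Hf) as [_ D0].
  intros z Hz. split; [auto|]. eapply holo_continuous; [apply holo_disc_C_derive|auto].
Qed.

Lemma Cderiv_inversion (zeta : C) : zeta <> 0%C ->
  Cderiv Cinv zeta (- (1) / (zeta * zeta)).
Proof. intros H. exact (Cderiv_inv (fun y => y) zeta 1 (Cderiv_id zeta) H). Qed.

Lemma Cderiv_exterior_recip zeta : 1 < Cmod zeta -> Cderiv recip_ext zeta (deriv_ext zeta).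
Proof.
  intros H. destruct (Cmod_inv_exterior zeta H) as (H0 & Hd & Hz).
  destruct (analytic_on_disc_derive f Hf) as [_ D0].
  assert (Hfz := Hne _ Hd Hz).
  replace (deriv_ext zeta) with (- (C_derive f (/ zeta) * (- (1) / (zeta * zeta))) / (f (/ zeta) * f (/ zeta)))%C
    by (unfold deriv_ext; field; auto).
  apply (Cderiv_inv (fun y => f (/ y)%C)); auto.
  apply (Cderiv_comp f Cinv); auto. now apply Cderiv_inversion.
Qed.

Lemma holo_exterior : holo (fun zeta => 1 < Cmod zeta) deriv_ext.
Proof.
  assert (Hi : holo (fun zeta => 1 < Cmod zeta) (fun y => / y)%C).
  { apply holo_inv; [apply holo_id|]. intros z Hz. now apply Cmod_inv_exterior. }
  assert (Hfi : holo (fun zeta => 1 < Cmod zeta) (fun y => f (/ y))%C).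
  { apply (holo_comp _ in_disc f (fun y => / y)%C); auto using holo_disc_analytic.
    intros z Hz. now apply Cmod_inv_exterior. }
  unfold deriv_ext. C_holo; auto.
  - apply (holo_comp _ in_disc (C_derive f) (fun y => / y)%C); auto using holo_disc_C_derive.
    intros z Hz. now apply Cmod_inv_exterior.
  - apply (holo_inv _ (fun y => f (/ y) * f (/ y))%C); [now C_holo|].
    intros z Hz. destruct (Cmod_inv_exterior z Hz) as (_ & H1 & H2).
    apply Cmult_neq_0; auto.
Qed.

Lemma Re_exterior_pos zeta : 1 < Cmod zeta -> 0 < Re (deriv_ext zeta).
Proof.
  intros H. destruct (Cmod_inv_exterior zeta H) as (H0 & Hd & Hz).
  replace (deriv_ext zeta) with ((/ zeta / f (/ zeta)) ^ 2 * C_derive f (/ zeta))%C; auto.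
  unfold deriv_ext. simpl. field; auto.
Qed.

(** Both estimates come from the disc of radius [|zeta| - 1] about [zeta], on which the
    derivative has positive real part and [1 / f (1 / .)] has no zero. *)
Lemma exterior_estimates zeta d : 1 < Cmod zeta -> Cderiv deriv_ext zeta d ->
  Cmod d * (Cmod zeta - 1) <= 4 * Cmod (deriv_ext zeta) /\
  Cmod (deriv_ext zeta) * (Cmod zeta - 1) <= 128 * Cmod (recip_ext zeta).
Proof.
  intros H Hd.
  assert (HQ : holo (fun w => Cmod (w - zeta) < Cmod zeta - 1) deriv_ext)
    by (apply (holo_sub (fun zeta => 1 < Cmod zeta)); [apply disc_in_exterior|apply holo_exterior]).
  assert (HP : forall w, Cmod (w - zeta) < Cmod zeta - 1 -> 0 <= Re (deriv_ext w)).
  { intros w Hw. left. now apply Re_exterior_pos, (disc_in_exterior zeta). }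
  split.
  - eapply Rle_trans; [apply (Re_pos_deriv_bound deriv_ext zeta); auto; lra|].
    assert (H1 := re_le_Cmod (deriv_ext zeta)). assert (H2 := Rle_abs (Re (deriv_ext zeta))). lra.
  - apply nonvanishing_lower_bound; auto; [lra|].
    intros w Hw. apply disc_in_exterior in Hw. split; [now apply Cderiv_exterior_recip|].
    destruct (Cmod_inv_exterior w Hw) as (H0 & Hw1 & Hw2).
    apply Cmod_gt_0. unfold recip_ext. rewrite Cmod_inv by auto.
    apply Rinv_0_lt_compat, Cmod_gt_0; auto.
Qed.

Lemma C_derive_nonzero z : in_disc z -> z <> 0%C -> C_derive f z <> 0%C.
Proof.
  intros Hd Hz E. assert (H := Hpos z Hd Hz). rewrite E, Cmult_0_r in H. simpl in H; lra.
Qed.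

(** Let [z = 1 / zeta], let [W] and [Q] be the values of [recip_ext] and [deriv_ext] at
    [zeta], and [D] the derivative of [deriv_ext] there.  Logarithmic differentiation gives
    [f'' / f' = - D / (z^2 Q) - 2 / z + 2 Q / (z^2 W)];
    the first and last terms are bounded by [exterior_estimates]. *)
Lemma pre_schwarzian_bound z : in_disc z -> z <> 0%C ->
  (1 - Cmod z ^ 2) * Cmod (pre_schwarzian f z) <= 522 / Cmod z.
Proof.
  intros Hd Hz.
  assert (Ht : 0 < Cmod z) by now apply Cmod_gt_0. assert (Ht1 : Cmod z < 1) by exact Hd.
  set (zeta := (/ z)%C).
  assert (Ezeta : (/ zeta)%C = z) by (unfold zeta; field; auto).
  assert (Hzeta : zeta <> 0%C).
  { intros E. rewrite E in Ezeta. apply Hz. rewrite <- Ezeta.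
    unfold Cinv, RtoC; simpl. f_equal; unfold Rdiv; ring. }
  assert (Hm : Cmod zeta = (/ Cmod z)%R) by (unfold zeta; now apply Cmod_inv).
  assert (H1 : 1 < Cmod zeta).
  { rewrite Hm, <- Rinv_1. apply Rinv_lt_contravar; lra. }
  destruct (analytic_on_disc_derive f Hf) as [A1 D0].
  destruct (analytic_on_disc_derive _ A1) as [A2 D1].
  assert (Hfz := Hne z Hd Hz). assert (Hbz := C_derive_nonzero z Hd Hz).
  set (u := f z) in *. set (v := C_derive f z) in *. set (w := C_derive (C_derive f) z).
  assert (Hi : Cderiv Cinv zeta (- (z * z))).
  { replace (- (z * z))%C with (- (1) / (zeta * zeta))%C by (unfold zeta; field; auto).
    now apply Cderiv_inversion. }
  assert (Hfi : Cderiv (fun y => f (/ y)%C) zeta (v * - (z * z))).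
  { apply (Cderiv_comp f Cinv); auto. rewrite Ezeta. now apply D0. }
  assert (HQ : Cderiv deriv_ext zeta (- (z * z) * (2 * z * v / (u * u) + z * z * w / (u * u) - 2 * (z * z) * (v * v) / (u * u * u)))).
  { match goal with |- Cderiv _ _ ?d => evar (d' : C); replace d with d' end.
    - unfold deriv_ext. apply Cderiv_mult; [apply Cderiv_mult|apply (Cderiv_inv (fun y => f (/ y) * f (/ y))%C)].
      + apply (Cderiv_comp (C_derive f) Cinv); [|exact Hi]. rewrite Ezeta. now apply D1.
      + apply (Cderiv_mult Cinv Cinv); exact Hi.
      + apply (Cderiv_mult (fun y => f (/ y)%C) (fun y => f (/ y)%C)); exact Hfi.
      + rewrite Ezeta. now apply Cmult_neq_0.
    - unfold d'. rewrite !Ezeta. fold u v w. field; auto. }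
  destruct (exterior_estimates zeta _ H1 HQ) as [B1 B2].
  set (D := (- (z * z) * (2 * z * v / (u * u) + z * z * w / (u * u) - 2 * (z * z) * (v * v) / (u * u * u)))%C) in *.
  assert (EQ : deriv_ext zeta = (v * (z * z) / (u * u))%C).
  { unfold deriv_ext. rewrite !Ezeta. fold u v. field; auto. }
  assert (EW : recip_ext zeta = (/ u)%C) by (unfold recip_ext; now rewrite Ezeta).
  assert (HQ0 : deriv_ext zeta <> 0%C).
  { intros E. assert (H := Re_exterior_pos zeta H1). rewrite E in H. simpl in H; lra. }
  assert (HW0 : 0 < Cmod (recip_ext zeta)).
  { rewrite EW, Cmod_inv by auto. now apply Rinv_0_lt_compat, Cmod_gt_0. }
  assert (Epre : pre_schwarzian f z =
     (- (D / (z * z * deriv_ext zeta)) + (- (2 / z) + 2 * (deriv_ext zeta / (recip_ext zeta * (z * z)))))%C).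
  { unfold pre_schwarzian. fold v w. rewrite EQ, EW. unfold D. field; auto. }
  set (t := Cmod z) in *.
  assert (HmQ : 0 < Cmod (deriv_ext zeta)) by now apply Cmod_gt_0.
  assert (HW0' : recip_ext zeta <> 0%C) by now apply Cmod_gt_0.
  assert (Hbound : Cmod (pre_schwarzian f z) <= Cmod D / (t * t * Cmod (deriv_ext zeta)) +
     (2 / t + 2 * (Cmod (deriv_ext zeta) / (Cmod (recip_ext zeta) * (t * t))))).
  { assert (C2 : Cmod 2 = 2) by (rewrite Cmod_R, Rabs_pos_eq; lra).
    assert (Hn0 : (z * z)%C <> 0%C) by now apply Cmult_neq_0.
    assert (Hn1 := Cmult_neq_0 _ _ Hn0 HQ0). assert (Hn2 := Cmult_neq_0 _ _ HW0' Hn0).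
    rewrite Epre.
    eapply Rle_trans; [apply Cmod_triangle|]. apply Rplus_le_compat.
    - rewrite Cmod_opp, (Cmod_div D _ Hn1), !Cmod_mult. apply Rle_refl.
    - eapply Rle_trans; [apply Cmod_triangle|].
      rewrite Cmod_opp, (Cmod_div 2 _ Hz), (Cmod_mult 2), (Cmod_div (deriv_ext zeta) _ Hn2), !Cmod_mult, C2.
      apply Rle_refl. }
  rewrite Hm in B1, B2. fold t in B1, B2.
  assert (Hrho : (/ t - 1 = (1 - t) / t)%R) by (field; lra). rewrite Hrho in B1, B2.
  assert (B1' : Cmod D / (t * t * Cmod (deriv_ext zeta)) <= 4 / (t * (1 - t))).
  { apply Rle_div_l; [apply Rmult_lt_0_compat; nra|].
    replace (Cmod D) with (Cmod D * ((1 - t) / t) * (t / (1 - t)))%R by (field; lra).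
    replace (4 / (t * (1 - t)) * (t * t * Cmod (deriv_ext zeta)))%R with (4 * Cmod (deriv_ext zeta) * (t / (1 - t)))%R by (field; lra).
    apply Rmult_le_compat_r; auto. apply Rdiv_le_0_compat; lra. }
  assert (B2' : Cmod (deriv_ext zeta) / (Cmod (recip_ext zeta) * (t * t)) <= 128 / (t * (1 - t))).
  { apply Rle_div_l; [apply Rmult_lt_0_compat; nra|].
    replace (Cmod (deriv_ext zeta)) with (Cmod (deriv_ext zeta) * ((1 - t) / t) * (t / (1 - t)))%R by (field; lra).
    replace (128 / (t * (1 - t)) * (Cmod (recip_ext zeta) * (t * t)))%R with (128 * Cmod (recip_ext zeta) * (t / (1 - t)))%R by (field; lra).
    apply Rmult_le_compat_r; auto. apply Rdiv_le_0_compat; lra. }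
  apply Rle_trans with ((1 - t ^ 2) * (260 / (t * (1 - t)) + 2 / t))%R.
  - apply Rmult_le_compat_l; [nra|].
    replace (260 / (t * (1 - t)))%R with (4 / (t * (1 - t)) + 2 * (128 / (t * (1 - t))))%R by (field; lra).
    lra.
  - replace ((1 - t ^ 2) * (260 / (t * (1 - t)) + 2 / t))%R with ((260 * (1 + t) + 2 * (1 - t ^ 2)) / t)%R by (field; lra).
    apply Rmult_le_compat_r; [left; now apply Rinv_0_lt_compat|]. nra.
Qed.

Lemma pre_schwarzian_bounded_near_0 : C_derive f 0 = 1%C ->
  exists delta M, 0 < delta /\ forall z, in_disc z -> Cmod z < delta ->
    (1 - Cmod z ^ 2) * Cmod (pre_schwarzian f z) <= M.
Proof.
  intros E1.
  assert (H0 : in_disc 0) by (unfold in_disc; rewrite Cmod_0; lra).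
  destruct (analytic_on_disc_derive f Hf) as [A1 _].
  destruct (analytic_on_disc_derive _ A1) as [A2 D1].
  destruct (analytic_on_disc_derive _ A2) as [_ D2].
  assert (C1 := Cderiv_continuous _ _ _ (D1 _ H0)).
  assert (C2 := Cderiv_continuous _ _ _ (D2 _ H0)).
  assert (L1 := proj1 (continuous_Cmod_lt _ _) C1 (/ 2) ltac:(lra)).
  assert (L2 := proj1 (continuous_Cmod_lt _ _) C2 1 ltac:(lra)).
  apply locally_Cmod in L1 as (d1 & Hd1 & L1). apply locally_Cmod in L2 as (d2 & Hd2 & L2).
  exists (Rmin d1 d2), (2 * (Cmod (C_derive (C_derive f) 0) + 1))%R.
  split; [now apply Rmin_glb_lt|]. intros z Hd Hz.
  assert (Hz1 := Rlt_le_trans _ _ _ Hz (Rmin_l _ _)).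
  assert (Hz2 := Rlt_le_trans _ _ _ Hz (Rmin_r _ _)).
  replace z with (z - 0)%C in Hz1, Hz2 by ring.
  specialize (L1 z Hz1). specialize (L2 z Hz2). rewrite E1 in L1.
  unfold pre_schwarzian.
  set (v := C_derive f z) in *. set (w := C_derive (C_derive f) z) in *. set (w0 := C_derive (C_derive f) 0) in *.
  assert (Hv : / 2 <= Cmod v).
  { assert (Cmod 1 <= Cmod (v - 1) + Cmod v); [|rewrite Cmod_1 in H; lra].
    replace (RtoC 1) with (- (v - 1) + v)%C at 1 by ring.
    eapply Rle_trans; [apply Cmod_triangle|]. rewrite Cmod_opp; lra. }
  assert (Hw : Cmod w <= Cmod w0 + 1).
  { replace w with ((w - w0) + w0)%C by ring. eapply Rle_trans; [apply Cmod_triangle|]. lra. }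
  assert (Hw0 := Cmod_ge_0 w). assert (Hz0 := Cmod_ge_0 z). unfold in_disc in Hd.
  assert (Hb : Cmod (w / v) <= 2 * (Cmod w0 + 1)).
  { rewrite Cmod_div by (apply Cmod_gt_0; lra). apply Rle_div_l; [lra|]. nra. }
  assert (Hq := Cmod_ge_0 (w / v)). nra.
Qed.
End Exterior.

Theorem theorem2p2 (alpha beta : R) (f : C -> C)
  (Halpha : (0 <= alpha < 1)%R) (Hbeta : (1 < beta)%R)
  (Hf : class_V alpha beta f) :
  Rbar_lt (pre_schwarzian_norm f) p_infty.
Proof.
  destruct Hf as ((HA & _ & H1) & Hne & HV).
  assert (Hpos : forall z, in_disc z -> z <> 0%C -> 0 < Re ((z / f z) ^ 2 * C_derive f z)%C).
  { intros z Hd Hz. assert (H := HV z Hd). unfold id_over in H.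
    destruct (Ceq_dec z 0); [easy|lra]. }
  destruct (pre_schwarzian_bounded_near_0 f HA H1) as (delta & M & Hdelta & HM).
  unfold pre_schwarzian_norm.
  match goal with |- Rbar_lt (Lub_Rbar ?E) _ =>
    destruct (Lub_Rbar_correct E) as [_ Hlub] end.
  apply Rbar_le_lt_trans with (Finite (Rmax M (522 / delta))); [|exact I].
  apply Hlub. intros x (z & Hd & ->). simpl.
  destruct (Rlt_le_dec (Cmod z) delta) as [Hz|Hz].
  - eapply Rle_trans; [now apply HM|apply Rmax_l].
  - eapply Rle_trans; [|apply Rmax_r].
    assert (Hz0 : z <> 0%C) by (apply Cmod_gt_0; lra).
    eapply Rle_trans; [now apply pre_schwarzian_bound|].
    apply Rmult_le_compat_l; [lra|]. apply Rinv_le_contravar; lra.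
Qed.
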